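(* Let $\{X_t\}$ be an irreducible Markov chain on a countable state space $\Sigma$ for which there exist a function $V:\Sigma\to\mathbb R_+$ and constants $\nu_{\max},\gamma>0$ and $b\ge0$ such that: (1) the set $B=\{x\in\Sigma:V(x)\le b\}$ is finite; (2) for all $x,y\in\Sigma$ with $\mathbb P(X_{t+1}=y\mid X_t=x)>0$, $|V(y)-V(x)|\le\nu_{\max}$; (3) for all $x\in\Sigma$ with $V(x)>b$, $\mathbb E[V(X_{t+1})-V(X_t)\mid X_t=x]<-\gamma$. Then for any $i\in B$ and for all $k\in\mathbb Z_+$, $$\mathbb P_i(T_i>k)\le4\cdot2^{-k/R_i},$$ where $$R_i=O\left(\frac{H_i^B\,e^{2\eta\nu_{\max}}}{(1-\rho)(e^{\eta\nu_{\max}}-\rho)}\right).$$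
   Context: $\mathbb P_i(\cdot)=\mathbb P(\cdot\mid X_0=i)$, $\mathbb E_i[\cdot]=\mathbb E[\cdot\mid X_0=i]$; $T_i=\inf\{t\ge1:X_t=i\}$; $\mathbb Z_+$ denotes the positive integers. Restricted chain: with $S_0=0$ and $S_k=\min\{t>S_{k-1}:X_t\in B\}$, let $Y_t=X_{S_t}$, a Markov chain on $B$ with transition probabilities $P_Y(x,y)=\mathbb P(X_{S_1}=y\mid X_0=x)$ for $x,y\in B$. Let $T_i^B=\inf\{t\ge1:Y_t=i\}$ and $H_i^B=\max_{j\in B}\mathbb E_j[T_i^B]$. The scalars are $\eta=\frac{\gamma}{2(e-2)\nu_{\max}^2}$ and $\rho=1-\frac{\gamma^2}{4(e-2)\nu_{\max}^2}$. The claim asserts existence of a constant $R_i$ of the stated order for which the tail bound holds. *)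

(* Defs.v *)
From HB Require Import structures.
From mathcomp Require Import all_boot all_order all_algebra.
From mathcomp Require Import finmap.
From mathcomp Require Import all_classical all_reals all_analysis.

Set Implicit Arguments.
Unset Strict Implicit.
Unset Printing Implicit Defensive.

Import Order.TTheory GRing.Theory Num.Theory.
Local Open Scope classical_set_scope.
Local Open Scope ring_scope.

(* inf of a set of times, with values in nat + {oo}: None stands for oo. *)
Definition first_time (A : set nat) : option nat :=
  match pselect (exists n, `[< A n >]) with
  | left h => Some (ex_minn h)
  | right _ => None
  end.

Definition time_ereal (R : realType) (s : option nat) : \bar R :=
  if s is Some n then (n%:R)%:E else +oo%E.
Arguments time_ereal : clear implicits.

(* T_i = inf {t >= 1 : Z_t = i} *)
Definition return_time (Omega E : Type) (Z : nat -> Omega -> E) (i : E)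
    (w : Omega) : option nat :=
  first_time [set t | (1 <= t)%N /\ Z t w = i].

Section RestrictedChain.
Variables (Omega S : Type) (X : nat -> Omega -> S) (B : set S).

(* S_0 = 0 and S_k = min {t > S_(k-1) : X_t \in B} *)
Fixpoint visit_time (k : nat) (w : Omega) : option nat :=
  if k is k'.+1 then
    obind (fun s => first_time [set t | (s < t)%N /\ B (X t w)])
          (visit_time k' w)
  else Some 0%N.

(* Y_t = X_(S_t); the value is None when S_t = oo. *)
Definition restricted_chain (t : nat) (w : Omega) : option S :=
  omap (fun s => X s w) (visit_time t w).

End RestrictedChain.

Section MarkovChain.
Context {R : realType} {d : measure_display} {Omega : measurableType d}.

(* P(A | H); only meaningful when P H > 0. *)
Definition cond_prob (P : probability Omega R) (A H : set Omega) : R :=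
  fine (P (A `&` H)) / fine (P H).

Variable (S : countType).
Implicit Types (p : S -> S -> R) (X : nat -> Omega -> S).

Definition stochastic_matrix p : Prop :=
  (forall x y, 0 <= p x y) /\
  (forall x, \esum_(y in [set: S]) (p x y)%:E = 1%E).

(* X is a time-homogeneous Markov chain with transition matrix p; Pr i is the
   law P_i = P(. | X_0 = i) of the chain started at i. Giving the whole family
   makes P_i available for every state, without assuming that some initial
   distribution charges all of them. *)
Definition markov_chain p (Pr : S -> probability Omega R) X : Prop :=
  [/\ stochastic_matrix p,
      forall t x, measurable [set w | X t w = x],
      forall i, Pr i [set w | X 0%N w = i] = 1%E
    & forall i t (x : nat -> S) y,
        let past := [set w | forall m, (m <= t)%N -> X m w = x m] in
        (0 < Pr i past)%E ->
        cond_prob (Pr i) [set w | X t.+1 w = y] past = p (x t) y].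

Definition irreducible_chain (Pr : S -> probability Omega R) X : Prop :=
  forall x y, exists n, (0 < Pr x [set w | X n w = y])%E.

(* E[V(X_(t+1)) - V(X_t) | X_t = x], which by time-homogeneity is
   E_x[V(X_1) - V(X_0)]. *)
Definition drift (Pr : S -> probability Omega R) X (V : S -> R) (x : S) :
    \bar R :=
  (\int[Pr x]_w (V (X 1%N w) - V (X 0%N w))%:E)%E.

(* H_i^B = max_(j in B) E_j[T_i^B], for a finite set B *)
Definition max_restricted_return (Pr : S -> probability Omega R) X
    (B : set S) (i : S) : \bar R :=
  \big[maxe/-oo%E]_(j <- fset_set B)
    (\int[Pr j]_w
       time_ereal R (return_time (restricted_chain X B) (Some i) w))%E.

End MarkovChain.

Definition lyapunov_eta {R : realType} (gamma numax : R) : R :=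
  gamma / (2 * (expR 1 - 2) * numax ^+ 2).

Definition lyapunov_rho {R : realType} (gamma numax : R) : R :=
  1 - gamma ^+ 2 / (4 * (expR 1 - 2) * numax ^+ 2).

(* Main.v *)
Require Import Defs.
From HB Require Import structures.
From mathcomp Require Import all_boot all_order all_algebra.
From mathcomp Require Import finmap ring lra.
From mathcomp Require Import all_classical all_reals all_analysis.
From mathcomp Require Import measurable_realfun.

(* Let [Q f x] be the sum of [p x z * f z] over [z <> i], so that
   [P_x(T_i > n) = (Q^n 1)(x)], and let [g_n] be the expected number of visits
   to [B] at times [t < n] with [T_i > t]; thus [g_(n+1) = 1_B + Q g_n]. Counting
   visits along paths gives [g_n <= H] on [B], and then everywhere by the maximum
   principle. By Hajek's estimate, [psi = e^(eta (V - b))] off [B] and [psi = 0]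
   on [B] satisfies [Q psi <= rho psi] off [B] and [Q psi <= e^(eta numax)] on
   [B]. Hence, with [A = 2 e^(eta numax)], the functions
   [U_n = A (H + g_n) + psi] satisfy [Q U_n <= (1 - kappa) U_(n+1)] for
   [kappa = (1 - rho) / (6 e^(eta numax) H)]. As [U_n >= A H] everywhere and
   [U_n i <= 2 A H], iterating gives [P_i(T_i > n) <= 2 (1 - kappa)^n] and one
   can take [R_i = 1 / kappa].
   If [B] is the whole space then [gamma] is unconstrained and [psi = 0] works;
   if the maximal return time is infinite, irreducibility gives a finite bound
   on [g_n] to be used in place of [H]. *)

Import Order.TTheory GRing.Theory Num.Theory.
Local Open Scope classical_set_scope.
Local Open Scope ring_scope.

(** * Bounds on [e] and a quadratic bound on the exponential *)

Lemma expR1_gt_5_2 {R : realType} : 5 / 2 < expR 1 :> R.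
Proof.
(* Six factors are enough for [e^x >= 1 + x]: [(7/6)^6] is about 2.52. *)
have -> : expR 1 = expR (1 / 6) ^+ 6 :> R.
  by rewrite -expRM_natl; congr expR; lra.
apply: (@lt_le_trans _ _ ((7 / 6) ^+ 6)); first by lra.
by apply: lerXn2r; rewrite ?nnegrE ?expR_ge0//; have := expR_ge1Dx (1 / 6 : R); lra.
Qed.

(** From [e^(-1/6) >= 5/6] one gets [e <= (6/5)^6], about 2.986. *)
Lemma expR1_lt3 {R : realType} : expR 1 < 3 :> R.
Proof.
have e0 := expR_gt0 (- (1 / 6) : R).
have : expR (- (1 / 6)) ^+ 6 * expR 1 = 1 :> R.
  by rewrite -expRM_natl -expRD -[RHS]expR0; congr expR; lra.
have h : (5 / 6) ^+ 6 <= expR (- (1 / 6)) ^+ 6 :> R.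
  by apply: lerXn2r; rewrite ?nnegrE ?expR_ge0//; have := expR_ge1Dx (- (1 / 6) : R); lra.
have := expR1_gt_5_2 (R := R).
nra.
Qed.

(** For [k >= 2], [z^k <= z^2]; so the series from the quadratic term on is at most [z^2] times its
    value at 1, which is [e - 2]. This is the source of [e - 2] in [eta] and [rho]. *)
Lemma expR_le_quadratic {R : realType} (z : R) :
  `|z| <= 1 -> expR z <= 1 + z + (expR 1 - 2) * z ^+ 2.
Proof.
move=> z1.
have cvz := @is_cvg_series_exp_coeff R z.
have cv1 := @is_cvg_series_exp_coeff R 1.
have cvR : (fun n => 1 + z + (series (exp_coeff 1) n - 2) * z ^+ 2) @ \oo -->
    1 + z + (expR 1 - 2) * z ^+ 2.
  apply: cvgD; first exact: cvg_cst.
  by apply: cvgMr_tmp; apply: cvgB; [exact: cv1|exact: cvg_cst].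
rewrite -(cvg_lim _ cvR)//.
rewrite {1}/expR.
apply: ler_lim; [exact: cvz|exact: cvgP cvR|].
exists 2%N => // -[|[|n]] // _.
rewrite /series /= !big_nat_recl//= /exp_coeff/= !expr0 !expr1 !fact0 !divr1.
rewrite addrA lerD2l (_ : forall s : R, 1 + (1 + s) - 2 = s); last by move=> s; lra.
rewrite mulr_suml; apply: ler_sum => k _.
rewrite expr1n mul1r mulrC ler_pM2l ?invr_gt0 ?ltr0n ?fact_gt0//.
apply: le_trans (ler_norm _) _.
rewrite normrX -[k.+2]addn2 exprD -(real_normK (num_real z)) ler_piMl ?sqr_ge0//.
exact: exprn_ile1.
Qed.

(** * Sums of nonnegative extended reals *)

Lemma esumZl {R : realType} (T : choiceType) (I : set T) (r : R) (a : T -> \bar R) :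
  0 <= r -> (forall x, 0 <= a x)%E ->
  (\esum_(x in I) (r%:E * a x) = r%:E * \esum_(x in I) a x)%E.
Proof.
(* One inequality suffices: with factor [1/r] and family [r * a] it yields the converse. *)
have le_half (s : R) (c : T -> \bar R) : 0 <= s -> (forall x, 0 <= c x)%E ->
    (\esum_(x in I) (s%:E * c x) <= s%:E * \esum_(x in I) c x)%E.
  move=> s0 c0; apply: ge_ereal_sup => _ [A [finA AI] <-].
  rewrite -ge0_mule_fsumr//; apply: lee_wpmul2l => //.
  by apply: esum_ge; exists A.
rewrite le_eqVlt => /predU1P[<-|r0] a0.
  by rewrite mul0e esum1// => x _; rewrite mul0e.
apply/le_anti; rewrite le_half ?(ltW r0)//=.
rewrite -lee_pdivlMl//.
apply: (le_trans _ (le_half _ _ _ _)); [|by rewrite invr_ge0 ltW|].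
  by apply: le_esum => x _; rewrite muleA -EFinM mulVf ?gt_eqF// mul1e.
by move=> x; rewrite mule_ge0// lee_fin ltW.
Qed.

Lemma esum_exchange {R : realType} (T1 T2 : choiceType) (I : set T1) (J : set T2)
    (a : T1 -> T2 -> \bar R) : (forall x y, 0 <= a x y)%E ->
  (\esum_(x in I) \esum_(y in J) a x y = \esum_(y in J) \esum_(x in I) a x y)%E.
Proof.
move=> a0; rewrite !esum_esum//.
rewrite (@reindex_esum _ _ _ (J `*` I) _ (fun k => (k.2, k.1))) //.
split; first by move=> [x y] [].
  by move=> [x y] [x' y'] _ _ [-> ->].
by move=> [x y] [Ix Jy]; exists (y, x).
Qed.

(** * The kernel of the chain killed on entering [i] *)

Section KilledKernel.
Context {R : realType} {S : countType} (p : S -> S -> R) (i : S).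
Hypothesis p_stoch : stochastic_matrix p.
Implicit Types (f g : S -> \bar R).

(* The chain may start at [i]; it is killed when it enters [i] afterwards. *)
Definition killed f (x : S) : \bar R :=
  (\esum_(z in [set~ i]) ((p x z)%:E * f z))%E.

Let p_ge0 x y : (0 <= (p x y)%:E)%E.
Proof. by case: p_stoch => p0 _; rewrite lee_fin. Qed.

(** Comparing only along possible transitions lets the jump bound on [V] be used under the sum. *)
Lemma le_killed f g x : (forall z, z <> i -> (0 < p x z)%R -> f z <= g z)%E ->
  (killed f x <= killed g x)%E.
Proof.
move=> fg; apply: le_esum => z zi.
have := p_ge0 x z; rewrite lee_fin le_eqVlt => /predU1P[<-|p0].
  by rewrite !mul0e.
by rewrite lee_pmul2l//; exact: fg.
Qed.

Lemma killed_ge0 f x : (forall z, 0 <= f z)%E -> (0 <= killed f x)%E.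
Proof. by move=> f0; apply: esum_ge0 => z _; rewrite mule_ge0. Qed.

Lemma killed_le_esum f x : (forall z, 0 <= f z)%E ->
  (killed f x <= \esum_(z in [set: S]) ((p x z)%:E * f z))%E.
Proof.
move=> f0; rewrite /killed esum_mkcond; apply: le_esum => z _.
by case: ifP => // _; rewrite mule_ge0.
Qed.

Lemma killedD f g x : (forall z, 0 <= f z)%E -> (forall z, 0 <= g z)%E ->
  killed (fun z => f z + g z)%E x = (killed f x + killed g x)%E.
Proof.
move=> f0 g0; rewrite /killed -esumD; [|by move=> *; rewrite mule_ge0..].
by apply: eq_esum => z _; rewrite ge0_muleDr.
Qed.

Lemma killedZl (r : R) f x : 0 <= r -> (forall z, 0 <= f z)%E ->
  killed (fun z => r%:E * f z)%E x = (r%:E * killed f x)%E.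
Proof.
move=> r0 f0; rewrite /killed -esumZl//; last by move=> *; rewrite mule_ge0.
by apply: eq_esum => z _; rewrite muleCA.
Qed.

Lemma killed_cst (r : R) x : 0 <= r -> (killed (fun=> r%:E) x <= r%:E)%E.
Proof.
move=> r0; apply: le_trans (@killed_le_esum _ x _) _ => //.
under eq_esum do rewrite muleC.
by rewrite esumZl// (proj2 p_stoch) mule1.
Qed.

Lemma iter_killed_ge0 f n x : (forall z, 0 <= f z)%E -> (0 <= iter n killed f x)%E.
Proof. by move=> f0; elim: n x => [|n IH] x //=; apply: killed_ge0. Qed.

Lemma le_iter_killed f g n x : (forall z, z <> i -> f z <= g z)%E -> x <> i ->
  (iter n killed f x <= iter n killed g x)%E.
Proof.
move=> fg; elim: n x => [|n IH] x xi /=; first exact: fg.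
by apply: le_killed => z zi _; exact: IH.
Qed.

Lemma iter_killedZl (r : R) f n x : 0 <= r -> (forall z, 0 <= f z)%E ->
  iter n killed (fun z => r%:E * f z)%E x = (r%:E * iter n killed f x)%E.
Proof.
move=> r0 f0; elim: n x => [|n IH] x //=.
rewrite -killedZl//; last by move=> z; exact: iter_killed_ge0.
by congr (killed _ x); apply/funext => z; exact: IH.
Qed.

(** As [1 <= U_0 / L], each application of the kernel costs a factor [lam] and raises the index of
    [U] by one. The index is there because occupation times are truncated at finite horizons. *)
Lemma iter_killed_geometric (lam L : R) (U : nat -> S -> R) n x :
  0 <= lam -> 0 < L -> (forall n z, L <= U n z) ->
  (forall n z, killed (fun y => (U n y)%:E) z <= (lam * U n.+1 z)%:E)%E ->
  (iter n killed (fun=> 1%E) x <= (lam ^+ n * (U n x / L))%:E)%E.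
Proof.
move=> lam0 L0 LU KU; elim: n x => [|n IH] x /=.
  by rewrite expr0 mul1r lee_fin lter_pdivlMr// mul1r.
have U0 m z : 0 <= U m z by rewrite (le_trans (ltW L0)).
have c0 : 0 <= lam ^+ n / L by rewrite divr_ge0 ?exprn_ge0 // ltW.
apply: (@le_trans _ _ (killed (fun y => (lam ^+ n / L)%:E * (U n y)%:E)%E x)).
  apply: le_killed => z _ _; apply: le_trans (IH z) _.
  by rewrite -EFinM lee_fin mulrA mulrAC.
rewrite killedZl//; last by move=> z; rewrite lee_fin.
apply: le_trans (lee_wpmul2l _ (KU n x)) _; first by rewrite lee_fin.
by rewrite -EFinM exprSr lee_fin le_eqVlt; apply/orP; left; apply/eqP; ring.
Qed.

(** * Expected occupation times before killing *)

Section OccupationTime.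
Variable D : set S.

(* The expected number of visits to [D] at times [t < n] with [T_i > t]. *)
Definition occupation n : S -> \bar R :=
  iter n (fun f x => (\1_D x)%:E + killed f x)%E (fun=> 0%E).

Lemma occupation_ge0 n x : (0 <= occupation n x)%E.
Proof.
by elim: n x => [|n IH] x //=; rewrite adde_ge0 ?killed_ge0 ?lee_fin.
Qed.

(** Links the recursion to probabilities: the term at [t] is the chance of being in [D] at time [t]
    and not yet killed. *)
Lemma occupation_sum n x :
  occupation n x = (\sum_(t < n) iter t killed (fun z => (\1_D z)%:E) x)%E.
Proof.
elim: n x => [|n IH] x; first by rewrite big_ord0.
rewrite big_ord_recl /=; congr (_ + _)%E.
rewrite -/(occupation n) /killed -esum_sum; last first.
  by move=> z t _ _; rewrite mule_ge0// iter_killed_ge0.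
apply: eq_esum => z _; rewrite IH ge0_sume_distrr//.
by move=> t _; exact: iter_killed_ge0.
Qed.

Lemma occupation_nondecreasing m n x : (m <= n)%N -> (occupation m x <= occupation n x)%E.
Proof.
move=> /subnK <-; rewrite !occupation_sum addnC big_split_ord/= leeDl//.
by apply: sume_ge0 => t _; exact: iter_killed_ge0.
Qed.

Lemma occupation_le n x : (occupation n x <= n%:R%:E)%E.
Proof.
elim: n x => [|n IH] x //=; rewrite -nat1r EFinD leeD//.
  by rewrite lee_fin indicE lern1 leq_b1.
apply: (le_trans _ (killed_cst _ x _)) => //.
by apply: le_killed => z _ _; exact: IH.
Qed.

(** The Markov property at time [m], at the level of the kernel. *)
Lemma occupation_split m n x :
  occupation (m + n) x = (occupation m x + iter m killed (occupation n) x)%E.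
Proof.
elim: m x => [|m IH] x; first by rewrite add0n add0e.
rewrite addSn /= -addeA; congr (_ + _)%E.
rewrite -killedD; last first.
- by move=> z; apply: iter_killed_ge0; exact: occupation_ge0.
- exact: occupation_ge0.
by congr (killed _ x); apply/funext => z; exact: IH.
Qed.

(* Maximum principle: off [D] the occupation time is an average of later ones. *)
Lemma occupation_max (M : R) n : 0 <= M ->
  (forall m x, (m <= n)%N -> x <> i -> D x -> occupation m x <= M%:E)%E ->
  forall m x, (m <= n)%N -> x <> i -> (occupation m x <= M%:E)%E.
Proof.
move=> M0 HD; elim=> [|m IH] x mn xi; first by rewrite /= lee_fin.
have [Dx|nDx] := pselect (D x); first exact: HD.
rewrite /= indicE memNset// add0e -/(occupation m).
apply: (le_trans _ (killed_cst _ x _)) => //; apply: le_killed => z zi _.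
by apply: IH => //; exact: ltnW.
Qed.

(** Let [q y < 1] be the probability of surviving [N y] steps from [y], and [s] the maximum of the
    occupation time over [D] without [i]. Splitting at [N y] bounds the occupation time at [y] by
    [N y + q y * s]; at a maximizer this gives [s <= N y / (1 - q y)], a bound free of the horizon
    [n]. *)
Lemma occupation_bounded : finite_set D ->
  (forall x, x <> i -> exists N, iter N killed (fun=> 1%E) x < 1)%E ->
  exists K : R, 0 <= K /\ forall n x, (occupation n x <= K%:E)%E.
Proof.
move=> finD exit_pos.
have {exit_pos} /choice[N HN] : forall x, exists N,
    x <> i -> (iter N killed (fun=> 1%E) x < 1)%E.
  move=> x; have [->|/exit_pos[N HN]] := pselect (x = i); first by exists 0%N.
  by exists N.
pose q x := fine (iter (N x) killed (fun=> 1%E) x).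
have q_lt1 x : x <> i -> q x < 1.
  move=> xi; rewrite -lte_fin fineK; first exact: HN.
  by rewrite ge0_fin_numE ?(lt_trans (HN _ xi)) ?ltry// iter_killed_ge0.
pose K := \sum_(x <- fset_set D) `|(N x)%:R / (1 - q x)|.
have K0 : 0 <= K by rewrite sumr_ge0.
have KN x : x <> i -> D x -> (N x)%:R <= K * (1 - q x).
  move=> xi Dx; rewrite -ler_pdivrMr ?subr_gt0 ?q_lt1//.
  apply: le_trans (ler_norm _) _.
  rewrite /K (bigD1_seq x)/= ?fset_uniq//; last by rewrite in_fset_set// inE.
  by rewrite lerDl sumr_ge0.
(* After one step the chain is killed or at a state other than [i], so starting at [i] costs at most
   1 more. *)
suff boundi n x : x <> i -> (occupation n x <= K%:E)%E.
  exists (1 + K); split; first by rewrite addr_ge0.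
  case=> [|n] x; first by rewrite /= lee_fin addr_ge0.
  rewrite /= EFinD leeD//; first by rewrite lee_fin indicE lern1 leq_b1.
  apply: (le_trans _ (killed_cst _ x _)) => //.
  by apply: le_killed => z zi _; exact: boundi.
move=> xi.
(* The default 0 covers the case where [D] has no state other than [i]. *)
pose s := \big[Num.max/0]_(y <- fset_set D | y != i) fine (occupation n y).
have occ_fin y : occupation n y \is a fin_num.
  by rewrite ge0_fin_numE ?occupation_ge0// (le_lt_trans (occupation_le _ _)) ?ltry.
have s0 : 0 <= s by exact: bigmax_ge_id.
have occ_s y : y <> i -> (occupation n y <= s%:E)%E.
  apply: (@occupation_max s n) => // m z mn zi Dz.
  apply: le_trans (occupation_nondecreasing _ _ z mn) _.
  rewrite -(fineK (occ_fin z)) lee_fin.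
  apply: (le_bigmax_seq 0 z (fun y => y != i) (fun y => fine (occupation n y))).
    by rewrite in_fset_set// inE.
  exact/eqP.
apply: le_trans (occ_s _ xi) _; rewrite lee_fin leNgt; apply/negP => Ks.
(* If [K < s], every term of the maximum is at most [N y + s * q y <= K * (1 - q y) + s * q y <
   s]. *)
suff : s < s by rewrite ltxx.
rewrite {1}/s big_seq_cond; apply: bigmax_lt; first exact: le_lt_trans Ks.
move=> y; rewrite in_fset_set// => /andP[/set_mem Dy /eqP yi].
have le1 : (occupation n y <= (N y)%:R%:E + s%:E * (q y)%:E)%E.
  apply: (le_trans (occupation_nondecreasing n (N y + n) y (leq_addl _ _))).
  rewrite occupation_split leeD//; first exact: occupation_le.
  rewrite fineK; last first.
    by rewrite ge0_fin_numE ?(lt_trans (HN _ yi)) ?ltry// iter_killed_ge0.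
  rewrite -iter_killedZl//; apply: le_iter_killed => // z zi.
  by rewrite mule1; exact: occ_s.
have : fine (occupation n y) <= (N y)%:R + s * q y.
  by rewrite -lee_fin fineK// EFinD EFinM.
move=> /le_lt_trans -> //.
have := KN _ yi Dy; have := q_lt1 _ yi.
nra.
Qed.

End OccupationTime.
End KilledKernel.

(** * Measure and integration for countable-valued variables *)

Section CountableValued.
Context {R : realType} {d : measure_display} {Omega : measurableType d} {T : countType}.
Variable Z : Omega -> T.
Hypothesis mZ : forall u, measurable [set w | Z w = u].

Lemma measurable_countable_valued (D : set T) : measurable [set w | D (Z w)].
Proof.
rewrite (_ : [set w | _] = \bigcup_u (if u \in D then [set w | Z w = u] else set0)).
  apply: countable_bigcupT_measurable => // u.
  by case: ifP.
apply/seteqP; split=> [w /= Dw|w [u _]]; first by exists (Z w) => //; rewrite mem_set.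
by case: ifPn => // /set_mem Du /= ->.
Qed.

Lemma measurable_fun_countable_valued {d'} {T' : measurableType d'} (A : set Omega)
  (f : T -> T') : measurable_fun A (fun w => f (Z w)).
Proof.
move=> mA Y _; apply: measurableI => //.
exact: (measurable_countable_valued (f @^-1` Y)).
Qed.

(** Cutting [A] by the code [pickle (Z w)] indexes the fibres by naturals, so countable additivity
    applies; codes of no value give empty pieces. *)
Lemma integral_countable_valued (mu : {measure set Omega -> \bar R}) (A : set Omega)
    (f : T -> \bar R) : measurable A -> (forall u, 0 <= f u)%E ->
  (\int[mu]_(w in A) f (Z w) =
   \esum_(u in [set: T]) (f u * mu (A `&` [set w | Z w = u])))%E.
Proof.
move=> mA f0; pose F k := A `&` [set w | choice.pickle (Z w) = k].
have AF : A = \bigcup_k F k.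
  by apply/seteqP; split=> [w Aw|w [k _] []//]; exists (choice.pickle (Z w)).
have mF k : measurable (F k).
  apply: measurableI => //.
  exact: (measurable_countable_valued [set u | choice.pickle u = k]).
rewrite {1}AF ge0_integral_bigcup//.
- rewrite nneseries_esumT; last by move=> k; exact: integral_ge0.
  pose I k := (\int[mu]_(w in F k) f (Z w))%E.
  transitivity (\esum_(k in range (@choice.pickle T)) I k)%E.
    rewrite [RHS]esum_mkcond; apply: eq_esum => k _; case: ifPn => //.
    rewrite notin_setE => nk; rewrite (_ : F k = set0) ?integral_set0//.
    by apply/seteqP; split=> // w [_ /= wk]; apply: nk; exists (Z w).
  rewrite esum_image; last by move=> u v _ _; exact: (pcan_inj (@choice.pickleK T)).
  apply: eq_esum => u _; rewrite /I.
  have -> : F (choice.pickle u) = A `&` [set w | Z w = u].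
    apply/seteqP; split=> w [Aw /= wu]; split=> //=; last by rewrite wu.
    exact: (pcan_inj (@choice.pickleK T)).
  rewrite -integral_cst//; last exact: measurableI.
  by apply: eq_integral => w /set_mem[_ /= ->].
- by move=> mF2 Y mY; apply: measurableI => //; exact: (measurable_countable_valued (f @^-1` Y)).
- by apply/trivIsetP => j k _ _ jk; apply/seteqP; split=> // w [[_ /= wj] [_ /= wk]];
    move/eqP: jk; rewrite -wj -wk.
Qed.

Lemma measure_countable_valued (mu : {measure set Omega -> \bar R}) (A : set Omega) :
  measurable A -> (mu A = \esum_(u in [set: T]) mu (A `&` [set w | Z w = u]))%E.
Proof.
move=> mA; rewrite -[LHS]mul1e -integral_cst//.
rewrite (integral_countable_valued mu A (fun=> 1%E))//.
by apply: eq_esum => u _; rewrite mul1e.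
Qed.

End CountableValued.

(** The integral is a supremum over simple functions below the integrand, hence monotone. It serves
    for the return time of the restricted chain, whose measurability is not established. *)
Lemma ge0_le_integral_nonmeasurable {R : realType} {d} {T : measurableType d}
    (mu : {measure set T -> \bar R}) (f g : T -> \bar R) :
  (forall x, 0 <= f x)%E -> (forall x, f x <= g x)%E ->
  (\int[mu]_x f x <= \int[mu]_x g x)%E.
Proof.
move=> f0 fg; rewrite !ge0_integralTE//; last by move=> x; exact: le_trans (fg x).
apply: le_ereal_sup => _ [h hf <-]; exists h => // x.
exact: le_trans (fg x).
Qed.

(** * First times of sets of naturals *)

Section FirstTime.
Implicit Types A : set nat.

Lemma first_time_Some A n : first_time A = Some n ->
  A n /\ forall m, A m -> (n <= m)%N.
Proof.
rewrite /first_time; case: pselect => // ex [<-].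
case: ex_minnP => m /asboolP Am minm; split=> // k Ak.
by apply: minm; exact/asboolP.
Qed.

Lemma first_time_None A n : first_time A = None -> ~ A n.
Proof.
rewrite /first_time; case: pselect => // nex _ An; apply: nex.
by exists n; exact/asboolP.
Qed.

Lemma time_gt_firstP {R : realType} A k :
  (k%:R%:E < time_ereal R (first_time A))%E <-> (forall m, (m <= k)%N -> ~ A m).
Proof.
case E : (first_time A) => [n|] /=; last first.
  by split=> [_ m _|_]; [exact: first_time_None|exact: ltry].
have [An minA] := first_time_Some _ _ E.
rewrite lte_fin ltr_nat; split=> [kn m mk Am|H].
  by have := leq_ltn_trans mk kn; rewrite ltnNge minA.
by rewrite ltnNge; apply/negP => /H.
Qed.

End FirstTime.

(** * Pathwise comparison of visits to [B] with the restricted chain *)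

Section Paths.
Context {R : realType} {Omega S : Type} (X : nat -> Omega -> S).

(* The event [T_i > t]. *)
Definition alive (i : S) (t : nat) : set Omega :=
  [set w | forall s, (1 <= s <= t)%N -> X s w <> i].

Lemma return_time_gt i k :
  [set w | (k%:R%:E < time_ereal R (return_time X i w))%E] = alive i k.
Proof.
apply/seteqP; split=> w /=.
  by move/time_gt_firstP => H s /andP[s1 sk] Xs; apply: (H s).
by move=> H; apply/time_gt_firstP => m mk [m1 Xm]; apply: (H m) => //; rewrite m1.
Qed.

Lemma return_time_ge1 i w : (1 <= time_ereal R (return_time X i w))%E.
Proof.
rewrite /return_time; case E : (first_time _) => [n|] /=; last exact: leey.
by have [[n1 _] _] := first_time_Some _ _ E; rewrite lee_fin ler1n.
Qed.

Variable B : set S.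

(** No visit occurs strictly between consecutive [S_k], so each step adds at most the visit at the
    earlier one; [S_0 = 0] need not be a visit. The bound [n <= s] later gives [1 <= s]. *)
Lemma visit_time_count n w s : visit_time X B n w = Some s ->
  (n <= s)%N /\ (\sum_(0 <= t < s) `[< B (X t w) >] <= n)%N.
Proof.
elim: n s => [|n IH] s /=; first by case=> <-; rewrite big_nil.
case E : (visit_time X B n w) => [r|] //= /first_time_Some[[rs _] mins].
have [nr cnt] := IH _ E; split; first exact: leq_ltn_trans rs.
rewrite (@big_cat_nat _ _ _ r.+1)//= big_nat_recr//= [X in (_ + X)%N]big_nat_cond [X in (_ + X)%N]big1.
  by rewrite addn0 -(addn1 n) leq_add// leq_b1.
move=> t /andP[/andP[rt ts] _]; case: asboolP => // Bt.
by move: ts; rewrite ltnNge mins.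
Qed.

(* Visits to [B] before time [T_i] happen before the [T_i^B]-th visit. *)
Lemma visits_le_restricted_return i n w :
  (\sum_(t < n) (\1_(alive i t `&` [set v | B (X t v)]) w)%:E <=
   time_ereal R (return_time (restricted_chain X B) (Some i) w))%E.
Proof.
rewrite /return_time; case E : (first_time _) => [m|] /=; last exact: leey.
have [[m1 +] _] := first_time_Some _ _ E; rewrite /restricted_chain.
case F : (visit_time X B m w) => [s|] //= [Xs].
have [ms cnt] := visit_time_count _ _ _ F.
rewrite sumEFin lee_fin.
pose c t : nat := w \in (alive i t `&` [set v | B (X t v)]).
rewrite (_ : \sum_(t < n) _ = (\sum_(t < n) c t)%:R); last first.
  by rewrite natr_sum; apply: eq_bigr => t _; rewrite indicE.
rewrite ler_nat; apply: leq_trans cnt.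
rewrite -(big_mkord xpredT c).
(* Enlarging the range to [n + s] allows a cut at [s] whichever of [n] and [s] is larger; from [s]
   on nothing is alive, as [X_s = i]. *)
apply: (@leq_trans (\sum_(0 <= t < n + s) c t)).
  by rewrite (@big_cat_nat _ _ _ n 0 (n + s))//= ?leq_addr//.
rewrite (@big_cat_nat _ _ _ s 0 (n + s))//= ?leq_addl// [X in (_ + X)%N]big_nat_cond [X in (_ + X)%N]big1.
  rewrite addn0; apply: leq_sum => t _; rewrite /c.
  by case: (boolP (w \in _)) => // /set_mem[_ /= /asboolT ->].
move=> t /andP[/andP[st _] _]; apply/eqP; rewrite eqb0 notin_setE => -[/(_ s) H _].
by apply: H => //; rewrite st (leq_trans m1).
Qed.

End Paths.

(** * Probabilities of the chain in terms of the killed kernel *)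

Section ChainLaw.
Context {R : realType} {d : measure_display} {Omega : measurableType d}.
Context {S : countType} (p : S -> S -> R) (Pr : S -> probability Omega R).
Variable X : nat -> Omega -> S.
Hypothesis mc : markov_chain p Pr X.

Lemma measurable_state t (D : set S) : measurable [set w | D (X t w)].
Proof. by case: mc => _ mX _ _; exact: measurable_countable_valued. Qed.

Lemma measurable_alive i t : measurable (alive X i t).
Proof.
rewrite (_ : alive X i t =
    \bigcap_s [set w | [set x | (1 <= s <= t)%N -> x <> i] (X s w)]).
  by apply: bigcapT_measurable => s; exact: measurable_state.
by apply/seteqP; split=> [w H s _|w H s]; [exact: H|exact: H s I].
Qed.

Lemma init_prob y x : Pr y [set w | X 0%N w = x] = (x == y)%:R%:E.
Proof.
case: mc => _ mX P0 _; have [->|xy] := eqVneq x y; first exact: P0.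
apply/eqP; rewrite eq_le measure_ge0 andbT.
apply: (@le_trans _ _ (Pr y (~` [set w | X 0%N w = y]))).
  apply: le_measure; rewrite ?inE//; first exact: measurableC.
  by move=> w /= ->; exact/eqP.
by rewrite probability_setC// P0 subee.
Qed.

(** The Markov property conditions on a whole past, so the event is split along the countably many
    paths [(X_0, ..., X_t)]. *)
Lemma killed_step_prob i y t x z :
  (Pr y (alive X i t `&` [set w | X t.+1 w = z] `&` [set w | X t w = x]) =
   (p x z)%:E * Pr y (alive X i t `&` [set w | X t w = x]))%E.
Proof.
case: (mc) => -[p0 _] mX _ Markov.
pose Z w := [tuple X m w | m < t.+1].
have mpast (a : nat -> S) : measurable [set w | forall m, (m <= t)%N -> X m w = a m].
  rewrite (_ : [set w | _] =
      \bigcap_m [set w | [set v | (m <= t)%N -> v = a m] (X m w)]).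
    by apply: bigcapT_measurable => s; exact: measurable_state.
  by apply/seteqP; split=> [w H s _|w H s]; [exact: H|exact: H s I].
have ZE u w : Z w = u <-> forall m, (m <= t)%N -> X m w = nth y u m.
  split=> [<- m mt|H].
    by rewrite (_ : m = Ordinal (mt : (m < t.+1)%N))// -tnth_nth tnth_mktuple.
  by apply: eq_from_tnth => m; rewrite tnth_mktuple (tnth_nth y) H// -ltnS.
have mZ u : measurable [set w | Z w = u].
  rewrite (_ : [set w | _] = [set w | forall m, (m <= t)%N -> X m w = nth y u m]).
    exact: mpast.
  by apply/seteqP; split=> w /ZE.
have mE : measurable (alive X i t `&` [set w | X t w = x]).
  by apply: measurableI => //; exact: measurable_alive.
rewrite setIAC (measure_countable_valued Z mZ) ?[in RHS](measure_countable_valued Z mZ)//;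
  last exact: measurableI.
rewrite -esumZl//; apply: eq_esum => u _.
set E := alive X i t `&` _; rewrite setIAC.
(* Membership in [E] depends only on the path up to [t]: the piece is empty or is the full past
   event of a sample [w0]. *)
have [[w0 [[al0 Xt0] Z0]]|none] := pselect (exists w, (E `&` [set w | Z w = u]) w); last first.
  rewrite (_ : E `&` _ = set0) ?set0I ?measure0 ?mule0//.
  by apply/seteqP; split=> // w Ew; apply: none; exists w.
pose past := [set w | forall m, (m <= t)%N -> X m w = X m w0].
have -> : E `&` [set w | Z w = u] = past.
  have {}Z0 := (ZE _ _).1 Z0.
  apply/seteqP; split=> [w [_ /ZE Zw] m mt|w pw]; first by rewrite Zw// Z0.
  split; last by apply/ZE => m mt; rewrite pw// Z0.
  split; last by rewrite /= pw.
  by move=> s /andP[s1 st]; rewrite pw//; apply: al0; rewrite s1.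
change (Pr y (past `&` [set w | X t.+1 w = z]) = (p x z)%:E * Pr y past)%E.
have fin1 : Pr y past \is a fin_num := fin_num_measure (Pr y) past (mpast _).
have mI : measurable (past `&` [set w | X t.+1 w = z]).
  by apply: measurableI => //; exact: mpast.
have fin2 : Pr y (past `&` [set w | X t.+1 w = z]) \is a fin_num :=
  fin_num_measure (Pr y) _ mI.
(* On a null past the conditional probability says nothing, but both sides vanish. *)
have [/eqP P0|Pn0] := boolP (Pr y past == 0%E).
  rewrite P0 mule0; apply/eqP; rewrite eq_le measure_ge0 andbT -P0.
  by apply: le_measure; rewrite ?inE//; exact: mpast.
have Ppos : (0 < Pr y past)%E by rewrite lt0e Pn0 measure_ge0.
have := Markov y t (fun m => X m w0) z Ppos.
rewrite -/past /cond_prob setIC Xt0 => <-.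
rewrite -[in RHS](fineK fin1) -EFinM divfK ?fineK//.
by rewrite fine_eq0.
Qed.

(** A general [f] lets the induction peel off the last step, replacing [f] by [killed p i f]; the
    bounds 0 and 1 are preserved and keep all values finite. *)
Lemma killed_state_prob i t (f : S -> \bar R) y : (forall x, 0 <= f x <= 1)%E ->
  (\esum_(x in [set: S]) (f x * Pr y (alive X i t `&` [set w | X t w = x])) =
   iter t (killed p i) f y)%E.
Proof.
case: (mc) => p_stoch mX _ _; have [p0 _] := p_stoch.
elim: t f => [|t IH] f f01.
  transitivity (\esum_(x in [set y]) f x)%E; last first.
    by rewrite esum_set1//; have /andP[] := f01 y.
  rewrite [RHS]esum_mkcond; apply: eq_esum => x _.
  rewrite (_ : alive X i 0 = setT) ?setTI ?init_prob; last first.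
    by apply/seteqP; split=> // w _ [|s].
  have [->|xy] := eqVneq x y; first by rewrite mem_set// mule1.
  by rewrite memNset ?mule0//; exact/eqP.
have f0 x : (0 <= f x)%E by have /andP[] := f01 x.
have f1 x : (f x <= 1)%E by have /andP[] := f01 x.
have ffin x : f x \is a fin_num by rewrite ge0_fin_numE// (le_lt_trans (f1 x)) ?ltry.
pose a x := Pr y (alive X i t `&` [set w | X t w = x]).
have mal s : measurable (alive X i s) by exact: measurable_alive.
have afin x : a x \is a fin_num by apply: fin_num_measure; exact: measurableI.
have a0 x : (0 <= a x)%E by exact: measure_ge0.
transitivity (\esum_(z in [set~ i]) \esum_(x in [set: S]) (f z * ((p x z)%:E * a x)))%E.
  rewrite [RHS]esum_mkcond; apply: eq_esum => z _; case: ifPn => [/set_mem zi|].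
    rewrite -(fineK (ffin z)) esumZl//; last 2 first.
    - by rewrite fine_ge0.
    - by move=> x; rewrite mule_ge0 ?lee_fin.
    congr (_ * _)%E.
    rewrite (_ : _ `&` _ = alive X i t `&` [set w | X t.+1 w = z]).
      rewrite (measure_countable_valued (X t) (mX t)); last exact: measurableI.
      by apply: eq_esum => x _; exact: killed_step_prob.
    apply/seteqP; split=> w [al Xz]; split=> //.
      by move=> s /andP[s1 st]; apply: al; rewrite s1 leqW.
    move=> s /andP[s1]; rewrite leq_eqVlt => /predU1P[->|st]; last first.
      by apply: al; rewrite s1.
    by rewrite Xz.
  rewrite notin_setE => /contrapT zi; rewrite (_ : _ `&` _ = set0) ?measure0 ?mule0//.
  by apply/seteqP; split=> // w [/(_ t.+1) al /=]; rewrite zi; apply: al; rewrite ltnS leqnn.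
rewrite esum_exchange; last by move=> z x; rewrite !mule_ge0 ?lee_fin.
rewrite iterSr -IH; last first.
  move=> x; rewrite killed_ge0//=; apply: le_trans (killed_cst p i p_stoch 1 x ler01).
  by apply: le_killed.
apply: eq_esum => x _; rewrite -/(a x) muleC -(fineK (afin x)) -esumZl ?fine_ge0//.
  by apply: eq_esum => z _; rewrite muleCA muleC -muleA muleC -muleA [X in (_ * X)%E]muleC.
by move=> z; rewrite mule_ge0 ?lee_fin.
Qed.

Lemma killed_event_prob i t (D : set S) y :
  Pr y (alive X i t `&` [set w | D (X t w)]) =
  iter t (killed p i) (fun x => (\1_D x)%:E) y.
Proof.
case: (mc) => _ mX _ _.
have mA : measurable (alive X i t `&` [set w | D (X t w)]).
  by apply: measurableI; [exact: measurable_alive|exact: measurable_state].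
rewrite -(killed_state_prob i t (fun x => (\1_D x)%:E)); last first.
  by move=> x; rewrite !lee_fin indicE ler0n lern1 leq_b1.
rewrite (measure_countable_valued (X t) (mX t))//; apply: eq_esum => x _.
rewrite indicE -setIA; have [Dx|nDx] := boolP (x \in D).
  rewrite mul1e; congr (Pr y (_ `&` _)); apply/seteqP; split=> w; first by case.
  by move=> /= Xw; split=> //; rewrite Xw; exact/set_mem.
rewrite mul0e (_ : _ `&` (_ `&` _) = set0) ?measure0//.
by apply/seteqP; split=> // w [_ [/= + Xw]]; rewrite Xw => /mem_set; exact/negP.
Qed.

Lemma alive_prob i t y :
  Pr y (alive X i t) = iter t (killed p i) (fun=> 1%E) y.
Proof.
rewrite -[alive X i t]setIT -[setT]/[set w | setT (X t w)] killed_event_prob.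
by congr (iter t _ _ y); apply/funext => x; rewrite indicE in_setT.
Qed.

(** Expectation of the pathwise count of visits before killing. *)
Lemma occupation_le_return (B : set S) i n y :
  (occupation p i B n y <=
   \int[Pr y]_w time_ereal R (return_time (restricted_chain X B) (Some i) w))%E.
Proof.
have p_stoch : stochastic_matrix p by case: mc.
rewrite occupation_sum//.
under eq_bigr do rewrite -killed_event_prob.
have mV t : measurable (alive X i t `&` [set w | B (X t w)]).
  by apply: measurableI; [exact: measurable_alive|exact: measurable_state].
apply: (@le_trans _ _ (\int[Pr y]_w
    \sum_(t < n) (\1_(alive X i t `&` [set v | B (X t v)]) w)%:E)%E).
  rewrite ge0_integral_sum//; last first.
    move=> t; apply/measurable_EFinP; exact: measurable_indic.
  by apply: lee_sum => t _; rewrite integral_indic// setIT.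
apply: ge0_le_integral_nonmeasurable => w; first by apply: sume_ge0.
exact: visits_le_restricted_return.
Qed.

Lemma max_restricted_return_ge (B : set S) i y : finite_set B -> B y ->
  (\int[Pr y]_w time_ereal R (return_time (restricted_chain X B) (Some i) w) <=
   max_restricted_return Pr X B i)%E.
Proof.
move=> finB By; rewrite /max_restricted_return.
apply: (le_bigmax_seq -oo%E y xpredT (fun j => \int[Pr j]_w
  time_ereal R (return_time (restricted_chain X B) (Some i) w))%E) => //.
by rewrite in_fset_set// inE.
Qed.

Lemma max_restricted_return_ge1 (B : set S) i : finite_set B -> B i ->
  (1 <= max_restricted_return Pr X B i)%E.
Proof.
move=> finB Bi; apply: le_trans (max_restricted_return_ge B i i finB Bi).
rewrite -[leLHS](probability_setT (Pr i)) -[leLHS]mul1e -integral_cst//.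
by apply: ge0_le_integral_nonmeasurable => // w; exact: return_time_ge1.
Qed.

(** Irreducibility gives [n] with [X_n = i] of positive probability, and [x <> i] forces [n > 0], so
    this event excludes survival to [n]. *)
Lemma exit_prob i x : irreducible_chain Pr X -> x <> i ->
  exists N, (iter N (killed p i) (fun=> 1%E) x < 1)%E.
Proof.
case: (mc) => _ mX _ _ irr xi; have [n Pn] := irr x i; exists n.
have n0 : (0 < n)%N.
  case: n Pn => // ; rewrite init_prob; case: eqP => [ix|_]; last by rewrite ltxx.
  by case: xi.
rewrite -alive_prob; apply: (@le_lt_trans _ _ (Pr x (~` [set w | X n w = i]))).
  apply: le_measure; rewrite ?inE//; first exact: measurable_alive.
    exact: measurableC.
  by move=> w al /=; apply: al; rewrite n0 leqnn.
rewrite probability_setC//.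
by rewrite lteBlDr ?fin_num_measure// lteDl.
Qed.

(** [M] is the maximal return time when that is finite, and otherwise a finite constant from
    [occupation_bounded], trivially below it. *)
Lemma occupation_uniform_bound (B : set S) i : irreducible_chain Pr X ->
  finite_set B -> B i -> exists M : R,
  [/\ 1 <= M, (M%:E <= max_restricted_return Pr X B i)%E &
      forall n x, (occupation p i B n x <= M%:E)%E].
Proof.
move=> irr finB Bi.
have p_stoch : stochastic_matrix p by case: mc.
have H1 := max_restricted_return_ge1 B i finB Bi.
case E : (max_restricted_return Pr X B i) H1 => [h| |] // H1.
  have h1 : 1 <= h by rewrite -lee_fin.
  have h0 : 0 <= h by exact: le_trans h1.
  have occB n x : B x -> (occupation p i B n x <= h%:E)%E.
    move=> Bx; rewrite -E; apply: le_trans (occupation_le_return _ _ _ _) _.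
    exact: max_restricted_return_ge.
  exists h; split=> // n x; have [->|/eqP xi] := eqVneq x i; first exact: occB.
  by apply: (occupation_max p i p_stoch B h n) => // m z _ _; exact: occB.
have [K [K0 HK]] := occupation_bounded p i p_stoch B finB
  (fun x => exit_prob i x irr).
exists (1 + K); split; [by rewrite lerDl|exact: leey|].
move=> n x; apply: le_trans (HK n x) _.
by rewrite lee_fin lerDr.
Qed.

(** * One-step law and the drift as a sum *)

Lemma step_prob x z : Pr x [set w | X 1%N w = z] = (p x z)%:E.
Proof.
case: (mc) => -[p0 _] mX P0 Markov.
pose past := [set w | forall m, (m <= 0)%N -> X m w = x].
have pastE : past = [set w | X 0%N w = x].
  apply/seteqP; split=> [w|w /= Xw m]; first exact.
  by rewrite leqn0 => /eqP ->.
have Ppast : Pr x past = 1%E by rewrite pastE P0.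
have mpast : measurable past by rewrite pastE.
have Ppos : (0 < Pr x past)%E by rewrite Ppast.
have := Markov x 0%N (fun=> x) z Ppos.
rewrite -/past /cond_prob Ppast /= divr1 => <-.
rewrite fineK; last by apply: fin_num_measure; exact: measurableI.
have Pnull : Pr x (~` past) = 0%E by rewrite probability_setC// Ppast subee.
apply/eqP; rewrite eq_le; apply/andP; split; last first.
  by apply: le_measure; rewrite ?inE//; exact: measurableI.
rewrite -[leRHS]adde0 -Pnull.
apply: (@le_trans _ _ (Pr x (([set w | X 1%N w = z] `&` past) `|` ~` past))).
  apply: le_measure; rewrite ?inE//.
    by apply: measurableU; [exact: measurableI|exact: measurableC].
  by move=> w Xw; have [pw|npw] := pselect (past w); [left|right].
by apply: measureU2; [exact: measurableI|exact: measurableC].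
Qed.

(* [V y - V x + numax >= 0] along transitions, so the drift becomes a sum of
   nonnegative terms. *)
Lemma drift_esum (V : S -> R) (numax : R) x : 0 <= numax ->
  (forall y, 0 < p x y -> `|V y - V x| <= numax) ->
  (\esum_(y in [set: S])
     ((p x y)%:E * (Num.max 0 (V y - V x + numax))%:E) =
   drift Pr X V x + numax%:E)%E.
Proof.
case: (mc) => p_stoch mX P0 _; have [p0 _] := p_stoch.
move=> numax0 jump.
(* Truncation makes the increment bounded, hence integrable; it changes [V] increments only on a
   null event, where [X_0] is not [x] or [X_1] is reached with probability zero. *)
pose h y := if `|V y - V x| <= numax then V y - V x else 0.
have habs y : `|h y| <= numax by rewrite /h; case: ifP => //; rewrite normr0.
have hN y : 0 <= h y + numax by have := habs y; rewrite ler_norml; lra.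
have mh : measurable_fun setT (fun w => h (X 1%N w)).
  exact: (measurable_fun_countable_valued (X 1%N)).
have ih : (Pr x).-integrable setT (fun w => (h (X 1%N w))%:E).
  apply: measurable_bounded_integrable => //.
    by have /= := ltry (1 : R); rewrite -(probability_setT (Pr x)).
  exists numax; split; first exact: num_real.
  by move=> M numaxM w _ /=; rewrite (le_trans (habs _))// ltW.
have -> : drift Pr X V x = (\int[Pr x]_w (h (X 1%N w))%:E)%E.
  apply: ae_eq_integral => //.
  - apply/measurable_EFinP; apply: measurable_funB.
      exact: (measurable_fun_countable_valued (X 1%N) (mX _) _ V).
    exact: (measurable_fun_countable_valued (X 0%N) (mX _) _ V).
  - exact/measurable_EFinP.
  pose N : set S := [set y | ~ 0 < p x y].
  have mN : measurable [set w | N (X 1%N w)] by exact: measurable_state.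
  exists (~` [set w | X 0%N w = x] `|` [set w | N (X 1%N w)]); split.
  - apply: measurableU; first exact: measurableC.
    exact: mN.
  - apply/eqP; rewrite -measure_le0.
    apply: (@le_trans _ _ (Pr x (~` [set w | X 0%N w = x]) +
              Pr x [set w | N (X 1%N w)])%E).
      apply: measureU2; first exact: measurableC.
      exact: mN.
    rewrite probability_setC// P0 subee// add0e.
    rewrite (measure_countable_valued (X 1%N) (mX 1%N)); last first.
      exact: mN.
    rewrite esum1// => y _; apply/eqP; rewrite eq_le measure_ge0 andbT.
    have [py|py] := pselect (0 < p x y).
      rewrite (_ : _ `&` _ = set0) ?measure0//.
      by apply/seteqP; split=> // w [/= + Xw]; rewrite Xw.
    apply: (@le_trans _ _ (Pr x [set w | X 1%N w = y])).
      apply: le_measure; rewrite ?inE//; first exact: measurableI.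
    by rewrite step_prob lee_fin leNgt; exact/negP.
  move=> w /= nE; apply: contrapT => /not_orP[/contrapT X0 /contrapT py].
  by apply: nE => _; rewrite X0 /h jump.
have -> : (\int[Pr x]_w (h (X 1%N w))%:E + numax%:E =
    \int[Pr x]_w (h (X 1%N w) + numax)%:E)%E.
  transitivity (\int[Pr x]_w (h (X 1%N w))%:E + \int[Pr x]_w numax%:E)%E.
    congr (_ + _)%E; rewrite integral_cst// -[LHS]mule1; congr (_ * _)%E.
    by symmetry; exact: probability_setT.
  rewrite -integralD_EFin//.
  by apply: finite_measure_integrable_cst.
rewrite (integral_countable_valued (X 1%N) (mX 1%N) (Pr x) setT (fun y => (h y + numax)%:E))//.
apply: eq_esum => y _; rewrite setTI [RHS]muleC [X in (_ = X * _)%E](step_prob x y).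
have := p0 x y; rewrite le_eqVlt => /predU1P[<-|py]; first by rewrite !mul0e.
by have := hN y; rewrite /h jump// => ?; rewrite max_r.
Qed.

End ChainLaw.

(** * Estimates on [eta], [rho] and the factor in the bound *)

Section Scalars.
Context {R : realType} (gamma numax : R).
Hypotheses (gamma0 : 0 < gamma) (numax0 : 0 < numax).
Let c : R := expR 1 - 2.
Let eta := lyapunov_eta gamma numax.
Let rho := lyapunov_rho gamma numax.
Let u := eta * numax.

Let c_bounds : 1 / 2 < c < 1.
Proof. by have := @expR1_gt_5_2 R; have := @expR1_lt3 R; rewrite /c; lra. Qed.

Let c0 : 0 < c. Proof. by move: c_bounds; lra. Qed.

Lemma lyapunov_eta_gt0 : 0 < eta.
Proof. by rewrite /eta /lyapunov_eta -/c divr_gt0// !mulr_gt0// exprn_gt0. Qed.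

Let u0 : 0 < u. Proof. by rewrite mulr_gt0// lyapunov_eta_gt0. Qed.

Lemma lyapunov_rhoE : 1 - rho = c * u ^+ 2.
Proof.
rewrite /u /rho /eta /lyapunov_rho /lyapunov_eta -/c; field.
by rewrite !gt_eqF.
Qed.

(** The left side is [1 + c * u^2 - eta * gamma] with [eta * gamma = 2 * c * u^2]; this [eta]
    minimizes it. *)
Lemma lyapunov_rho_identity :
  (1 - u + c * u ^+ 2) + eta * (numax - gamma) = rho.
Proof.
rewrite /u /rho /eta /lyapunov_rho /lyapunov_eta -/c; field.
by rewrite !gt_eqF.
Qed.

Lemma lyapunov_rho_lt1 : rho < 1.
Proof. by rewrite -subr_gt0 lyapunov_rhoE mulr_gt0// exprn_gt0. Qed.

(** Since [2 * c > 1]; this puts the exponents in the range of [expR_le_quadratic]. *)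
Lemma lyapunov_u_lt1 : gamma < numax -> u < 1.
Proof.
move=> gn; rewrite /u /eta /lyapunov_eta -/c.
rewrite mulrAC ltr_pdivrMr ?mulr_gt0 ?exprn_gt0// mul1r expr2.
rewrite mulrA ltr_pM2r//; apply: (lt_trans gn).
rewrite -[ltLHS]mul1r ltr_pM2r//; move: c_bounds; lra.
Qed.

Lemma lyapunov_rho_ge0 : gamma < numax -> 0 <= rho.
Proof.
move=> /lyapunov_u_lt1 u1; have := lyapunov_rhoE.
by move: c_bounds u0 u1; nra.
Qed.

Definition lyapunov_factor : R :=
  expR (2 * eta * numax) / ((1 - rho) * (expR (eta * numax) - rho)).

Let den_gt0 : 0 < (1 - rho) * (expR u - rho).
Proof.
have r1 := lyapunov_rho_lt1.
rewrite mulr_gt0// subr_gt0//; apply: (lt_trans r1).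
by rewrite expR_gt1.
Qed.

Let num_sqr : expR (2 * eta * numax) = expR u * expR u.
Proof. by rewrite -expRD; congr expR; rewrite /u; ring. Qed.

(** For the case where [B] is everything and [gamma] may exceed [numax]. From [e^u >= (1 + u/2)^2]
    one gets [1 - rho = c * u^2 <= 4 * e^u], so the denominator is at most [4 * e^u * (5 * e^u)]. *)
Lemma lyapunov_factor_ge : 1 <= 20 * lyapunov_factor.
Proof.
rewrite mulrA ler_pdivlMr// mul1r num_sqr lyapunov_rhoE.
have -> : rho = 1 - c * u ^+ 2 by rewrite -lyapunov_rhoE; ring.
have sq : u ^+ 2 <= 4 * expR u.
  rewrite (_ : u = u / 2 + u / 2); last by field.
  rewrite expRD; have := expR_ge1Dx (u / 2); move: u0; nra.
have e0 := expR_gt0 u.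
have cu : c * u ^+ 2 <= 4 * expR u by move: c_bounds; nra.
have cu0 : 0 <= c * u ^+ 2 by rewrite mulr_ge0 ?sqr_ge0// ltW.
nra.
Qed.

(** Because [rho >= 0], [e^u - rho <= e^u] cancels one of the two factors [e^u] above. *)
Lemma lyapunov_factor_ge_expR : gamma < numax ->
  expR u / (1 - rho) <= lyapunov_factor.
Proof.
move=> gn; rewrite /lyapunov_factor num_sqr invfM mulrA ler_pdivlMr; last first.
  by rewrite subr_gt0 (lt_trans lyapunov_rho_lt1)// expR_gt1.
rewrite mulrAC ler_pM2r ?invr_gt0 ?subr_gt0 ?lyapunov_rho_lt1//.
by rewrite ler_pM2l ?expR_gt0// lerBlDr lerDl lyapunov_rho_ge0.
Qed.

Lemma lyapunov_factor_gt0 : 0 < lyapunov_factor.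
Proof. by rewrite divr_gt0 ?expR_gt0. Qed.

(** The quadratic bound, with [(eta * t)^2 <= u^2], regrouped as nonnegative terms so that it can be
    summed against [p]. *)
Lemma expR_lyapunov_le (t : R) : `|t| <= numax -> gamma < numax ->
  expR (eta * t) <= (1 - u + c * u ^+ 2) + eta * (t + numax).
Proof.
move=> tn gn; have e0 := lyapunov_eta_gt0.
have ut : `|eta * t| <= u by rewrite normrM (gtr0_norm e0) ler_pM2l.
apply: le_trans (expR_le_quadratic _ (le_trans ut (ltW (lyapunov_u_lt1 gn)))) _.
have : (eta * t) ^+ 2 <= u ^+ 2 by rewrite -real_normK ?num_real// lerXn2r// nnegrE ltW.
rewrite -/c => sq; have := ler_wpM2l (ltW c0) sq.
rewrite [eta * (t + numax)]mulrDr -/u; lra.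
Qed.

Lemma lyapunov_intercept_ge0 : gamma < numax -> 0 <= 1 - u + c * u ^+ 2.
Proof.
move=> /lyapunov_u_lt1 u1; rewrite addr_ge0 ?subr_ge0 ?(ltW u1)//.
by rewrite mulr_ge0 ?sqr_ge0// ltW.
Qed.

End Scalars.

(* The rate is [1 / kappa] because [(1 - kappa)^k <= e^(- kappa k)] and
   [2 <= e]. *)
Lemma geometric_le_powR2 {R : realType} (kappa : R) k : 0 < kappa <= 1 ->
  (1 - kappa) ^+ k <= 2 `^ (- (k%:R / kappa^-1)).
Proof.
move=> /andP[k0 k1]; rewrite invrK /powR (_ : 2 == 0 = false); last by apply/negbTE; lra.
apply: (@le_trans _ _ (expR (- kappa) ^+ k)).
  rewrite lerXn2r ?nnegrE ?subr_ge0 ?expR_ge0//; exact: expR_ge1Dx.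
rewrite -expRM_natl ler_expR mulNr mulrN lerN2.
rewrite ler_piMr ?mulr_ge0 ?(ltW k0)//.
by have := @le_ln1Dx R 1; rewrite (_ : 1 + 1 = 2 :> R); [apply; lra|ring].
Qed.

(** * The exponential Lyapunov function *)

Section Lyapunov.
Context {R : realType} {d : measure_display} {Omega : measurableType d}.
Context {S : countType} (p : S -> S -> R) (Pr : S -> probability Omega R).
Variable X : nat -> Omega -> S.
Hypothesis mc : markov_chain p Pr X.
Variables (V : S -> R) (numax gamma b : R) (i : S).
Hypotheses (numax0 : 0 < numax) (gamma0 : 0 < gamma).
Hypothesis jump : forall x y, 0 < p x y -> `|V y - V x| <= numax.
Hypothesis driftV : forall x, b < V x -> (drift Pr X V x < (- gamma)%:E)%E.
Let B := [set x | V x <= b].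
Let eta := lyapunov_eta gamma numax.
Let rho := lyapunov_rho gamma numax.
Let u := eta * numax.

Let p_stoch : stochastic_matrix p. Proof. by case: mc. Qed.

Let p_ge0 x y : 0 <= p x y. Proof. by case: p_stoch. Qed.

Let drift_sum x : b < V x -> (\esum_(y in [set: S])
  ((p x y)%:E * (Num.max 0 (V y - V x + numax))%:E) <= (numax - gamma)%:E)%E.
Proof.
move=> bx; rewrite (drift_esum p Pr X mc V numax x (ltW numax0))//; last exact: jump.
by rewrite [numax - gamma]addrC EFinD leeD2r// ltW// driftV.
Qed.

(** Jumps bounded by [numax] keep the drift at or above [- numax]. *)
Lemma gamma_lt_numax x : b < V x -> gamma < numax.
Proof.
move=> bx; rewrite -subr_gt0 -lte_fin.
rewrite addrC EFinD.
apply: (@le_lt_trans _ _ (drift Pr X V x + numax%:E)%E).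
  rewrite -(drift_esum p Pr X mc V numax x (ltW numax0))//; last exact: jump.
  by apply: esum_ge0 => y _; rewrite mule_ge0 ?lee_fin// le_max lexx.
by rewrite lteD2rE// driftV.
Qed.

Lemma exp_drift x : b < V x ->
  (\esum_(y in [set: S]) ((p x y)%:E * (expR (eta * (V y - V x)))%:E) <= rho%:E)%E.
Proof.
move=> bx; have gn := gamma_lt_numax x bx.
pose K := 1 - u + (expR 1 - 2) * u ^+ 2.
have K0 : 0 <= K by exact: lyapunov_intercept_ge0.
have eta0 : 0 <= eta by exact: ltW (lyapunov_eta_gt0 _ _ gamma0 numax0).
have m0 y : 0 <= Num.max 0 (V y - V x + numax) by rewrite le_max lexx.
apply: (@le_trans _ _ (\esum_(y in [set: S]) (K%:E * (p x y)%:E +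
    eta%:E * ((p x y)%:E * (Num.max 0 (V y - V x + numax))%:E)))%E).
  apply: le_esum => y _; rewrite -!EFinM -EFinD lee_fin.
  have := p_ge0 x y; rewrite le_eqVlt => /predU1P[<-|py].
    by rewrite !mul0r !mulr0 addr0.
  rewrite mulrCA (mulrC K) -mulrDr ler_pM2l//.
  apply: le_trans (expR_lyapunov_le gamma numax gamma0 numax0 _ (jump _ _ py) gn) _.
  by rewrite lerD2l ler_wpM2l// le_max lexx orbT.
have p0 y : (0 <= (p x y)%:E)%E by rewrite lee_fin.
have pm0 y : (0 <= (p x y)%:E * (Num.max 0 (V y - V x + numax))%:E)%E.
  by rewrite mule_ge0 ?lee_fin.
rewrite esumD; [|by move=> y _; rewrite mule_ge0// lee_fin..].
rewrite !esumZl//.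
rewrite (proj2 p_stoch) mule1 /rho -(lyapunov_rho_identity gamma numax numax0).
rewrite [leRHS]EFinD leeD2l//; apply: (@le_trans _ _ (eta%:E * (numax - gamma)%:E)%E).
  by apply: lee_wpmul2l; [rewrite lee_fin|exact: drift_sum].
by rewrite -EFinM.
Qed.

(** The value 0 on [B] keeps [psi] from contributing at [i], and being below the exponential it
    preserves upper bounds on [killed]. *)
Definition lyapunov_psi (x : S) : R :=
  if V x <= b then 0 else expR (eta * (V x - b)).

Lemma lyapunov_psi_ge0 x : 0 <= lyapunov_psi x.
Proof. by rewrite /lyapunov_psi; case: ifP => // _; exact: expR_ge0. Qed.

Lemma lyapunov_psi_ge1 x : b < V x -> 1 <= lyapunov_psi x.
Proof.
move=> bx; rewrite /lyapunov_psi (leNgt (V x)) bx /= -expR0 ler_expR mulr_ge0 ?subr_ge0 ?ltW//.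
exact: lyapunov_eta_gt0.
Qed.

Lemma killed_psi_out x : b < V x ->
  (killed p i (fun y => (lyapunov_psi y)%:E) x <= (rho * lyapunov_psi x)%:E)%E.
Proof.
move=> bx; apply: (le_trans (killed_le_esum p i p_stoch _ x _)).
  by move=> z; rewrite lee_fin lyapunov_psi_ge0.
have -> : lyapunov_psi x = expR (eta * (V x - b)) by rewrite /lyapunov_psi (leNgt (V x)) bx.
apply: (@le_trans _ _ (\esum_(y in [set: S])
  ((expR (eta * (V x - b)))%:E * ((p x y)%:E * (expR (eta * (V y - V x)))%:E)))%E).
  apply: le_esum => y _; rewrite -!EFinM lee_fin mulrCA ler_wpM2l//.
  rewrite -expRD -mulrDr (_ : V x - b + (V y - V x) = V y - b); last by ring.
  by rewrite /lyapunov_psi; case: ifP => // _; exact: expR_ge0.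
rewrite esumZl ?expR_ge0//; last by move=> y; rewrite mule_ge0 ?lee_fin ?expR_ge0.
rewrite [X in (_ <= X%:E)%E]mulrC EFinM lee_wpmul2l ?lee_fin ?expR_ge0//.
exact: exp_drift.
Qed.

Lemma killed_psi_in x : V x <= b ->
  (killed p i (fun y => (lyapunov_psi y)%:E) x <= (expR u)%:E)%E.
Proof.
move=> xb; apply: (le_trans _ (killed_cst p i p_stoch (expR u) x (expR_ge0 _))).
apply: le_killed => // y _ py; rewrite lee_fin /lyapunov_psi.
case: ifPn => [_|]; first exact: expR_ge0.
rewrite -ltNge => yb; rewrite ler_expR ler_wpM2l//.
  exact: ltW (lyapunov_eta_gt0 _ _ gamma0 numax0).
have := jump _ _ py; rewrite ler_norml; lra.
Qed.

(** * Combining occupation times with the Lyapunov function *)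

Variable M : R.
Hypothesis M1 : 1 <= M.
Hypothesis occM : forall n x, (occupation p i B n x <= M%:E)%E.

Let occ n x := fine (occupation p i B n x).

Let occE n x : occupation p i B n x = (occ n x)%:E.
Proof.
rewrite fineK// ge0_fin_numE ?occupation_ge0//.
by rewrite (le_lt_trans (occM _ _)) ?ltry.
Qed.

Let occ_bounds n x : 0 <= occ n x <= M.
Proof. by rewrite -!lee_fin -occE occM occupation_ge0. Qed.

Let M0 : 0 < M. Proof. exact: lt_le_trans M1. Qed.

(** The recursion for occupation times gives [Q g_n = g_(n+1) - 1_B], so each step from [B] gains
    [A]. *)
Lemma killed_lyapunov (A r : R) (psi : S -> R) n x : 0 <= A ->
  (forall y, 0 <= psi y) -> (killed p i (fun y => (psi y)%:E) x <= r%:E)%E ->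
  (killed p i (fun y => (A * (M + occ n y) + psi y)%:E) x <=
   (A * (M + occ n.+1 x - \1_B x) + r)%:E)%E.
Proof.
move=> A0 psi0 psir.
have -> : (fun y => (A * (M + occ n y) + psi y)%:E) =
    (fun y => A%:E * (M%:E + occupation p i B n y) + (psi y)%:E)%E.
  by apply/funext => y; rewrite occE EFinD EFinM EFinD.
have q0 y : (0 <= M%:E + occupation p i B n y)%E.
  by rewrite adde_ge0 ?occupation_ge0 ?lee_fin ?ltW.
rewrite (killedD p i p_stoch); last 2 first.
- by move=> y; rewrite mule_ge0 ?lee_fin.
- by move=> y; rewrite lee_fin.
rewrite (killedZl p i p_stoch)// (killedD p i p_stoch); last 2 first.
- by move=> y; rewrite lee_fin ltW.
- exact: occupation_ge0.
rewrite EFinD leeD// EFinM lee_wpmul2l ?lee_fin// -addrA EFinD leeD//.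
  by apply: killed_cst => //; exact: ltW.
have := occE n.+1 x; rewrite [occupation _ _ _ _ _]/= -/(occupation p i B n) => oE.
by rewrite EFinB -oE addeC addeA -EFinN -EFinD addNr add0e.
Qed.

(** [U_n >= A * M] everywhere, while [psi i = 0] gives [U_n i <= 2 * A * M]; the ratio 2 fits under
    4. *)
Lemma tail_of_lyapunov (A kappa : R) (psi : S -> R) k :
  0 < A -> 0 < kappa <= 1 -> (forall y, 0 <= psi y) -> psi i = 0 ->
  (forall n x, killed p i (fun y => (A * (M + occ n y) + psi y)%:E) x <=
     ((1 - kappa) * (A * (M + occ n.+1 x) + psi x))%:E)%E ->
  (Pr i (alive X i k) <= (4 * 2 `^ (- (k%:R / kappa^-1)))%:E)%E.
Proof.
move=> A0 kap psi0 psii KU; have /andP[k0 k1] := kap.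
have AM : 0 < A * M by exact: mulr_gt0.
rewrite (alive_prob p Pr X mc).
have lam0 : 0 <= 1 - kappa by rewrite subr_ge0.
have LU n z : A * M <= A * (M + occ n z) + psi z.
  by have /andP[q0 _] := occ_bounds n z; rewrite mulrDr -addrA lerDl addr_ge0// mulr_ge0// ltW.
apply: (le_trans (iter_killed_geometric p i p_stoch _ _ _ k i lam0 AM LU KU)).
rewrite lee_fin psii addr0 mulrC; apply: ler_pM.
- apply: divr_ge0; last exact: ltW.
  by rewrite mulr_ge0 ?addr_ge0 ?(ltW A0) ?(ltW M0)//; have /andP[] := occ_bounds k i.
- by rewrite exprn_ge0.
- rewrite ler_pdivrMr// mulrCA ler_pM2l//.
  by have /andP[_] := occ_bounds k i; move: M0; lra.
exact: geometric_le_powR2.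
Qed.

Hypothesis Bi : B i.

(** With [A = 1] and [psi = 0], [U] loses 1 at every step and is at most [2 * M], whence
    [kappa = 1 / (2 * M)]. *)
Lemma tail_no_outside k : (forall x, V x <= b) ->
  (Pr i (alive X i k) <= (4 * 2 `^ (- (k%:R / (1 / (2 * M))^-1)))%:E)%E.
Proof.
move=> allB; have k0 : 0 < 1 / (2 * M) by rewrite divr_gt0// mulr_gt0.
apply: (tail_of_lyapunov 1 _ (fun=> 0)) => //.
  by rewrite k0 ler_pdivrMr ?mulr_gt0//; move: M1; lra.
move=> n x.
apply: (le_trans (killed_lyapunov 1 0 (fun=> 0) n x ler01 (fun=> lexx 0) _)).
  exact: killed_cst.
rewrite lee_fin indicE mem_set; last exact: allB.
rewrite !mul1r !addr0 mulrBl mul1r lerB// mulrC ler_pdivrMr ?mulr_gt0// mul1r.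
by have /andP[_] := occ_bounds n.+1 x; lra.
Qed.

Lemma tail_outside k x0 : b < V x0 ->
  (Pr i (alive X i k) <=
   (4 * 2 `^ (- (k%:R / ((1 - rho) / (6 * expR u * M))^-1)))%:E)%E.
Proof.
move=> x0b; have gn := gamma_lt_numax x0 x0b.
have rho1 : rho < 1 by exact: lyapunov_rho_lt1.
have rho0 : 0 <= rho by exact: lyapunov_rho_ge0.
have u0 : 0 < u by rewrite mulr_gt0//; exact: lyapunov_eta_gt0.
have eu : 1 < expR u by rewrite expR_gt1.
have D0 : 0 < 6 * expR u * M by rewrite !mulr_gt0// expR_gt0.
set kappa := (1 - rho) / _.
have kD : kappa * (6 * expR u * M) = 1 - rho by rewrite divfK// gt_eqF.
have kap0 : 0 < kappa by rewrite divr_gt0// subr_gt0.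
have eM : 1 <= expR u * M by move: M1; nra.
apply: (tail_of_lyapunov (2 * expR u) _ lyapunov_psi) => //.
- by rewrite mulr_gt0 ?expR_gt0.
- by rewrite kap0/=; nra.
- exact: lyapunov_psi_ge0.
- by rewrite /lyapunov_psi Bi.
move=> n x; have A0 : 0 <= 2 * expR u by rewrite mulr_ge0 ?expR_ge0.
have /andP[q0 qM] := occ_bounds n.+1 x.
have [xb|xb] := leP (V x) b.
  apply: (le_trans (killed_lyapunov _ _ _ n x A0 lyapunov_psi_ge0 (killed_psi_in x xb))).
  rewrite lee_fin indicE mem_set//= /lyapunov_psi xb addr0.
  rewrite [leRHS]mulrBl mul1r mulrBr mulr1 lerBrDr.
  (* Of the gain [2 * e^u], half pays for [Q psi <= e^u]; the other half covers [kappa * U], as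
     [U <= 4 * e^u * M] and [kappa * 6 * e^u * M = 1 - rho <= 1]. *)
  suff : kappa * (2 * expR u * (M + occ n.+1 x)) <= expR u by lra.
  apply: (@le_trans _ _ (kappa * (6 * expR u * M))).
    by rewrite ler_wpM2l ?ltW// -!mulrA; nra.
  by rewrite kD; lra.
apply: (le_trans (killed_lyapunov _ _ _ n x A0 lyapunov_psi_ge0 (killed_psi_out x xb))).
have psi1 := lyapunov_psi_ge1 x xb.
rewrite lee_fin indicE memNset/=; last by rewrite /B /=; lra.
rewrite subr0 [leRHS]mulrBl mul1r.
(* As [psi >= 1] and [e^u * M >= 1], the bracket is at most [(4 + 1) * e^u * M * psi], within the 6
   built into [kappa]. *)
suff : kappa * (2 * expR u * (M + occ n.+1 x) + lyapunov_psi x) <= (1 - rho) * lyapunov_psi x by lra.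
rewrite -kD -[leRHS]mulrA ler_wpM2l ?(ltW kap0)//.
have eo : expR u * occ n.+1 x <= expR u * M by rewrite ler_wpM2l ?expR_ge0.
by rewrite mulrDr; nra.
Qed.

End Lyapunov.

(** * Choice of [R_i] and of the universal constant *)

Theorem lemma9 (R : realType) :
  exists C : R, 0 < C /\
  forall (d : measure_display) (Omega : measurableType d) (S : countType)
    (p : S -> S -> R) (Pr : S -> probability Omega R) (X : nat -> Omega -> S)
    (V : S -> R) (numax gamma b : R),
    markov_chain p Pr X ->
    irreducible_chain Pr X ->
    (forall x, 0 <= V x) ->
    0 < numax -> 0 < gamma -> 0 <= b ->
    let B := [set x | V x <= b] in
    finite_set B ->
    (forall x y, 0 < p x y -> `|V y - V x| <= numax) ->
    (forall x, b < V x -> (drift Pr X V x < (- gamma)%:E)%E) ->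
    let eta := lyapunov_eta gamma numax in
    let rho := lyapunov_rho gamma numax in
    forall i, B i ->
    exists Ri : R,
      [/\ 0 < Ri,
          (Ri%:E <= (C * (expR (2 * eta * numax) /
                           ((1 - rho) * (expR (eta * numax) - rho))))%:E
                    * max_restricted_return Pr X B i)%E
        & forall k : nat, (0 < k)%N ->
          (Pr i [set w | k%:R%:E < time_ereal R (return_time X i w)]
            <= (4 * 2 `^ (- (k%:R / Ri)))%:E)%E].
Proof.
(* With [F] the [lyapunov_factor], 120 covers both cases: [R_i = 2 * M <= 40 * F * M] if [B] is
   everything, and [R_i = 6 * e^u * M / (1 - rho) <= 6 * F * M] otherwise. *)
exists 120; split=> // d Omega S p Pr X V numax gamma b mc irr V0 numax0 gamma0 b0.
move=> B finB jump driftV eta rho i Bi.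
have [M [M1 MH occM]] := occupation_uniform_bound p Pr X mc B i irr finB Bi.
have M0 : 0 < M by exact: lt_le_trans M1.
rewrite -/(lyapunov_factor gamma numax).
have F0 := lyapunov_factor_gt0 gamma numax gamma0 numax0.
have F20 := lyapunov_factor_ge gamma numax gamma0 numax0.
have le_H Ri : Ri <= 120 * lyapunov_factor gamma numax * M ->
    (Ri%:E <= (120 * lyapunov_factor gamma numax)%:E * max_restricted_return Pr X B i)%E.
  move=> RiM; apply: (@le_trans _ _ ((120 * lyapunov_factor gamma numax)%:E * M%:E)%E).
    by rewrite -EFinM lee_fin.
  by apply: lee_wpmul2l; rewrite // lee_fin mulr_ge0// ltW.
have [[x0 x0b]|noout] := pselect (exists x, b < V x); last first.
  exists (1 / (2 * M))^-1; split.
  - by rewrite invr_gt0 divr_gt0// mulr_gt0.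
  - by apply: le_H; rewrite div1r invrK; nra.
  move=> k _; rewrite return_time_gt.
  apply: (tail_no_outside p Pr X mc V b i M M1 occM k) => x.
  by rewrite leNgt; apply/negP => bx; apply: noout; exists x.
have gn := gamma_lt_numax p Pr X mc V numax gamma b numax0 jump driftV x0 x0b.
have rho1 : 0 < 1 - rho by rewrite subr_gt0; exact: lyapunov_rho_lt1.
exists ((1 - rho) / (6 * expR (eta * numax) * M))^-1; split.
- by rewrite invr_gt0 divr_gt0// !mulr_gt0// expR_gt0.
- apply: le_H; rewrite invf_div.
  have := lyapunov_factor_ge_expR gamma numax gamma0 numax0 gn.
  rewrite -/eta -/rho => FE.
  rewrite (_ : _ / _ = 6 * (expR (eta * numax) / (1 - rho)) * M); last by ring.
  by rewrite ler_pM2r//; move: FE F0; lra.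
move=> k _; rewrite return_time_gt.
exact: (tail_outside p Pr X mc V numax gamma b i numax0 gamma0 jump driftV M M1 occM Bi k x0).
Qed.
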